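(* Let $p$ be a prime number. (1) If $2^{\aleph_0}=\aleph_1$, then $\mathbf{K}^{p\text{-grp}}$ has a universal model of cardinality $\aleph_1$. (2) If $2^{\aleph_0}>\aleph_1$ and the combinatorial principle $\clubsuit$ holds, then $\mathbf{K}^{p\text{-grp}}$ does not have a universal model of cardinality $\aleph_1$.
   Context: An abelian $p$-group is an abelian group in which every nonzero element has order $p^n$ for some $n\in\mathbb{N}$. A subgroup $G$ of an abelian group $H$ is pure, written $G\leq_p H$, if $nH\cap G=nG$ for every $n\in\mathbb{N}$. A pure embedding is an injective homomorphism whose image is a pure subgroup of the codomain. $\mathbf{K}^{p\text{-grp}}$ denotes the class of abelian $p$-groups ordered by $\leq_p$. For an infinite cardinal $\lambda$, $\mathbf{K}^{p\text{-grp}}$ has a universal model of cardinality $\lambda$ if there is an abelian $p$-group $U$ of cardinality $\lambda$ such that for every abelian $p$-group $N$ of cardinality $\lambda$ there is a pure embedding $N\to U$. The principle $\clubsuit$ (on $\omega_1$) is the standard statement: there is a sequence $\langle A_\delta : \delta<\omega_1 \text{ a limit ordinal}\rangle$ such that each $A_\delta$ is an unbounded subset of $\delta$ of order type $\omega$, and for every uncountable $X\subseteq\omega_1$ there is a limit ordinal $\delta<\omega_1$ with $A_\delta\subseteq X$. *)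

(* Defs.v *)
From HB Require Import structures.
From mathcomp Require Import all_boot all_order all_algebra.
From mathcomp Require Import all_classical wochoice.
Set Implicit Arguments.
Unset Strict Implicit.
Unset Printing Implicit Defensive.
Import Order.TTheory GRing.Theory.
Local Open Scope classical_set_scope.
Local Open Scope card_scope.

(* The ordinal omega_1 is realised inside a well-ordering of 2^nat as the set  *)
(* of points with countably many predecessors. The lemmas omega1_wf,           *)
(* omega1_uncountable and omega1_countable_seg, with the total order instance, *)
(* characterise it up to isomorphism, whatever well-ordering is chosen.        *)
Definition wo_cantor : rel (nat -> bool) :=
  sval (well_ordering_principle (nat -> bool)).

Definition omega1 : Type :=
  {x : nat -> bool | `[< countable [set y | wo_cantor y x] >]}.

HB.instance Definition _ := Choice.on omega1.

Definition omega1_le (x y : omega1) : bool := wo_cantor (val x) (val y).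

Lemma wo_cantorP : well_order wo_cantor.
Proof. exact: (svalP (well_ordering_principle (nat -> bool))). Qed.

Lemma wo_cantor_min (A : set (nat -> bool)) :
  A !=set0 -> exists2 z, A z & forall x, A x -> wo_cantor z x.
Proof.
move=> [x Ax]; have [|z [[zA zmin] _]] := wo_cantorP (A := fun x => x \in A).
  by exists x; apply/mem_set.
exists z; first exact: set_mem.
by move=> y Ay; apply: zmin; apply/mem_set.
Qed.

Lemma wo_cantor_total : total wo_cantor.
Proof.
move=> x y.
have [|z [] ->] := wo_cantor_min (A := [set x; y]); first by exists x; left.
  by move=> /(_ y)-> //; right.
by move=> /(_ x)->; [rewrite orbT | left].
Qed.

Lemma wo_cantor_refl : reflexive wo_cantor.
Proof. by move=> x; have := wo_cantor_total x x; rewrite orbb. Qed.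

Lemma wo_cantor_anti : antisymmetric wo_cantor.
Proof.
move=> x y /andP[xy yx].
have [|z [_ zuniq]] := wo_cantorP (A := fun t => t \in [set x; y]).
  by exists x; apply/mem_set; left.
have zx : z = x.
  apply: zuniq; split; first by apply/mem_set; left.
  by move=> t /set_mem[] ->; rewrite ?wo_cantor_refl.
have zy : z = y.
  apply: zuniq; split; first by apply/mem_set; right.
  by move=> t /set_mem[] ->; rewrite ?wo_cantor_refl.
by rewrite -zx -zy.
Qed.

Lemma wo_cantor_trans : transitive wo_cantor.
Proof.
move=> y x z xy yz.
have [|m mA mmin] := wo_cantor_min (A := [set x; y; z]).
  by exists x; left; left.
have mx : wo_cantor m x by apply: mmin; left; left.
have my : wo_cantor m y by apply: mmin; left; right.
have mz : wo_cantor m z by apply: mmin; right.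
case: mA => [[] E|E]; first by rewrite -E.
  by have -> : x = y by apply: wo_cantor_anti; rewrite xy -E mx.
have E' : y = z by apply: wo_cantor_anti; rewrite yz -E my.
by rewrite -E'.
Qed.

Lemma omega1_le_refl : reflexive omega1_le.
Proof. by move=> x; apply: wo_cantor_refl. Qed.

Lemma omega1_le_anti : antisymmetric omega1_le.
Proof. by move=> x y /wo_cantor_anti/val_inj. Qed.

Lemma omega1_le_trans : transitive omega1_le.
Proof. by move=> y x z; apply: wo_cantor_trans. Qed.

Lemma omega1_le_total : total omega1_le.
Proof. by move=> x y; apply: wo_cantor_total. Qed.

HB.instance Definition _ := Order.Le_isPOrder.Build (Order.Disp tt tt) omega1
  omega1_le_refl omega1_le_anti omega1_le_trans.
HB.instance Definition _ := Order.POrder_isTotal.Build (Order.Disp tt tt) omega1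
  omega1_le_total.

Lemma omega1_wf (A : set omega1) :
  A !=set0 -> exists2 z, A z & forall x, A x -> (z <= x)%O.
Proof.
move=> [a Aa]; have [|_ [z Az <-] zmin] := wo_cantor_min (A := val @` A).
  by exists (val a), a.
by exists z => // x Ax; apply: zmin; exists x.
Qed.

Lemma omega1_countable_seg (x : omega1) : countable [set y | (y <= x)%O].
Proof.
have /asboolP/countable_injP[f finj] := svalP x.
apply/countable_injP; exists (f \o val) => y z /set_mem yx /set_mem zx /= fyz.
by apply: val_inj; apply: finj => //; apply/mem_set.
Qed.

Lemma cantor_uncountable : ~ countable [set: nat -> bool].
Proof.
move=> /countable_injP[f finj].
pose d n := `[< exists2 g : nat -> bool, f g = n & ~~ g n >].
have E : d (f d) = ~~ d (f d).
  apply/idP/idP => [/asboolP[g fg]|H].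
    by rewrite -{2 3}(finj g d) ?fg // inE.
  by apply/asboolP; exists d.
by case: (d (f d)) E.
Qed.

Lemma omega1_uncountable : ~ countable [set: omega1].
Proof.
move=> c1; pose B := [set x | ~ countable [set y | wo_cantor y x]].
have cB : countable (~` B).
  have -> : ~` B = val @` [set: omega1].
    apply/seteqP; split=> [x /contrapT cx|_ [x _ <-]]; last first.
      by move: (svalP x) => /asboolP cx; apply.
    by exists (Sub x (asboolT cx)).
  exact: sub_countable (card_image_le _ _) c1.
have [[b Bb]|B0] := pselect (B !=set0); last first.
  apply: cantor_uncountable; apply: sub_countable cB; apply: subset_card_le.
  by move=> x _ Bx; apply: B0; exists x.
have [z Bz zmin] := wo_cantor_min (ex_intro _ b Bb).
apply: Bz; apply: (@sub_countable _ _ _ (~` B `|` [set z])).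
  apply: subset_card_le => y yz.
  have [By|] := pselect (B y); last by left.
  by right; apply: wo_cantor_anti; rewrite yz zmin.
rewrite -bigcup2E; apply: bigcup_countable => // -[|[|i]] _ /=;
  [exact: cB|exact: countable1|exact: countable0].
Qed.

Definition card_lt T U (A : set T) (B : set U) : Prop :=
  (A #<= B) /\ ~ (B #<= A).

Section Club.
Local Open Scope order_scope.
Implicit Types (d x y : omega1) (A X : set omega1).

Definition limit_ordinal d : Prop :=
  (exists x, x < d) /\ (forall x, x < d -> exists2 y, x < y & y < d).

Definition unbounded_in d A : Prop :=
  A `<=` [set x | x < d] /\ (forall x, x < d -> exists2 y, A y & x < y).

Definition order_type_omega A : Prop :=
  exists2 f : nat -> omega1, {mono f : m n / (m <= n)%N >-> m <= n}
                           & range f = A.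

Definition club_principle : Prop :=
  exists A : omega1 -> set omega1,
    (forall d, limit_ordinal d ->
       unbounded_in d (A d) /\ order_type_omega (A d)) /\
    (forall X, ~ countable X -> exists2 d, limit_ordinal d & A d `<=` X).

End Club.

Section PGroups.
Local Open Scope ring_scope.

Definition has_order (G : zmodType) (x : G) (k : nat) : Prop :=
  [/\ (0 < k)%N, x *+ k = 0
    & forall m, (0 < m)%N -> x *+ m = 0 -> (k <= m)%N].

Definition abelian_p_group (p : nat) (G : zmodType) : Prop :=
  forall x : G, x <> 0 -> exists n : nat, has_order x (p ^ n).

Definition pure_subgroup (H : zmodType) (G : set H) : Prop :=
  zmod_closed (fun x => x \in G) /\
  forall n : nat, [set h *+ n | h in [set: H]] `&` G = [set g *+ n | g in G].

Definition pure_embedding (G H : zmodType) (f : {additive G -> H}) : Prop :=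
  injective f /\ pure_subgroup (range f).

(* A cardinal is given by a type L of that cardinality. *)
Definition has_universal_p_group (p : nat) (L : Type) : Prop :=
  exists U : zmodType,
    [/\ abelian_p_group p U, [set: U] #= [set: L]
      & forall N : zmodType, abelian_p_group p N -> [set: N] #= [set: L] ->
          exists f : {additive N -> U}, pure_embedding f].

End PGroups.

(* Main.v *)
Require Import Defs.
From HB Require Import structures.
From mathcomp Require Import all_boot all_order all_algebra.
From mathcomp Require Import all_classical.
From mathcomp Require Import zify.
Set Implicit Arguments.
Unset Strict Implicit.
Unset Printing Implicit Defensive.
Import Order.TTheory GRing.Theory.
Local Open Scope classical_set_scope.
Local Open Scope card_scope.

(** An embedding of p-groups is pure as soon as it reflects divisibility by the
    powers of p (pure_embedding_p_power), so both halves are about filtrations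
    by the subgroups p^k G.

    The continuum hypothesis. A p-group G has a maximal p-independent subset, a
    basis of a basic subgroup: modulo each p^k G, it is a basis of a direct sum
    of cyclic groups. The coordinates along this set are homomorphisms to the
    rationals modulo the integers, and they detect divisibility by p^k exactly
    (torsion_coordinates). Together they map G to the torsion completion of a
    direct sum of cyclic groups, with kernel the elements divisible by every
    p^k. A second map, to a direct sum of copies of the divisible group of
    rationals modulo integers, is injective (divisible_embedding) but forgets
    divisibility. Paired, they form a pure embedding, injective because of one
    component and pure because of the other. The target only has to offer
    enough coordinates of each exponent: with aleph_1 of them it receives every
    p-group of cardinality aleph_1, and as its elements have countable support
    its own cardinality is at most 2^aleph_0 = aleph_1.

    Club. Let U be a p-group enumerated in type omega_1, and on each limit d let
    a_0 < a_1 < ... be the ladder provided by club. An element u of U and an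
    ordinal d determine a code: the set of all j such that u does not lie in
    U_(a_j) + p^(j+1) U, where U_(a) consists of the elements enumerated before
    a. Only aleph_1 codes arise, fewer than the continuum. But every set r of
    natural numbers is a code if U is universal. Indeed there is a p-group N of
    cardinality aleph_1 generated by elements x(b, n) of order p^(n+1), for b in
    omega_1, and by the infinite sums y_d of the p^n x(a_n, n) over n in r,
    together with what is needed to divide the tails of y_d by p
    (coding_group); with respect to the elements generated by the x(b, n) with
    b < a_j, the code of y_d is r. A pure embedding of N into U preserves codes
    computed along ordinals that are closed under a suitable function
    (invariant_transfer). Those ordinals form an uncountable set, so club gives
    some d whose whole ladder consists of them. *)

(** * Cardinal arithmetic at aleph_1 *)

Lemma card_leTTP (T U : Type) :
  [set: T] #<= [set: U] <-> exists f : T -> U, injective f.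
Proof.
split=> [/card_leP/unsquash f|[f finj]].
  exists (fun x => val (f (to_setT x))) => x y /val_inj fxy.
  have: to_setT x = to_setT y by apply: (@inj _ _ _ f) => //; rewrite inE.
  by move/(congr1 val).
apply: card_le_trans (card_leT (range f)).
have /card_eqPle[_ //] : range f #= [set: T].
by apply: inj_card_eq => x y _ _; exact: finj.
Qed.

Lemma countable_injective (T U : Type) (f : T -> U) (A : set T) (B : set U) :
  injective f -> (forall x, A x -> B (f x)) -> countable B -> countable A.
Proof.
move=> finj AB /countable_injP[g ginj]; apply/countable_injP.
exists (g \o f) => x y /set_mem Ax /set_mem Ay /ginj/finj; apply; apply/mem_set.
  exact: AB.
exact: AB.
Qed.

Lemma countable_seq_over (T : eqType) (A : set T) :
  countable A -> countable [set s : seq T | forall x, x \in s -> A x].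
Proof.
move=> /countable_injP[f finj]; apply/countable_injP.
exists (fun s => pickle (map f s)) =>
  s t /set_mem As /set_mem At /(pcan_inj pickleK).
elim: s t As At => [|x s IH] [|y t] //= As At [fxy /IH st].
have Ax : A x by apply: As; rewrite inE eqxx.
have Ay : A y by apply: At; rewrite inE eqxx.
rewrite (finj _ _ (mem_set Ax) (mem_set Ay) fxy) st // => z zs.
  by apply: As; rewrite inE zs orbT.
by apply: At; rewrite inE zs orbT.
Qed.

Section Omega1.
Local Open Scope order_scope.

Lemma omega1_nonempty : [set: omega1] !=set0.
Proof.
apply: infinite_setN0 => fin; apply: omega1_uncountable.
exact: finite_set_countable.
Qed.

Lemma omega1_bounded (A : set omega1) :
  countable A -> exists b, forall a, A a -> a < b.
Proof.
move=> cA; apply/not_existsP => nb; apply: omega1_uncountable.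
have -> : [set: omega1] = \bigcup_(a in A) [set y | y <= a].
  apply/seteqP; split=> // b _; have /existsNP[a /not_implyP[Aa /negP]] := nb b.
  by rewrite -leNgt; exists a.
by apply: bigcup_countable => // a _; exact: omega1_countable_seg.
Qed.

Lemma omega1_lt_wf : well_founded (fun x y : omega1 => x < y).
Proof.
move=> x; apply: contrapT => nx.
have [z nz zmin] := omega1_wf (ex_intro [set y | ~ Acc _ y] x nx).
apply: nz; constructor => y yz; apply: contrapT => /zmin.
by rewrite leNgt yz.
Qed.

Lemma omega1_fresh (A : set omega1) : countable A ->
  exists2 g : nat -> omega1, injective g & forall n, ~ A (g n).
Proof.
move=> cA; have /infiniteP/card_leP/unsquash g : infinite_set (~` A).
  move=> /finite_set_countable cC; apply: omega1_uncountable.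
  rewrite -(setUv A) -bigcup2E; apply: bigcup_countable => // -[|[|i]] _ //=.
exists (fun n => val (g (to_setT n))) => [m n /val_inj gmn|n].
  have: to_setT m = to_setT n by apply: (@inj _ _ _ g) => //; rewrite inE.
  by move/(congr1 val).
by have /set_mem := valP (g (to_setT n)).
Qed.

(** By well-founded recursion each ordinal receives a countable block of values
    that avoids the blocks of its predecessors. *)
Lemma omega1_nat_le : [set: omega1 * nat] #<= [set: omega1].
Proof.
have {}/choice[fresh freshP] : forall A : set omega1,
    exists g : nat -> omega1, countable A -> injective g /\ forall n, ~ A (g n).
  move=> A; have [cA|ncA] := pselect (countable A); last first.
    by have [x _] := omega1_nonempty; exists (fun=> x).
  by have [g ginj gA] := omega1_fresh cA; exists g.
pose step (x : omega1) (F : forall y, y < x -> nat -> omega1) :=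
  fresh [set z | exists y (h : y < x) n, F y h n = z].
pose F := Fix omega1_lt_wf (fun=> nat -> omega1) step.
pose below x := [set z | exists2 y, y < x & exists n, F y n = z].
have FE x : F x = fresh (below x).
  rewrite /F Fix_eq => [|{}x f g fg]; last first.
    by congr (step x _); apply: functional_extensionality_dep => y;
      apply: funext.
  congr fresh; apply/seteqP; split=> z.
    by move=> [y [yx [n <-]]]; exists y => //; exists n.
  by move=> [y yx [n <-]]; exists y, yx, n.
have cbelow x : countable (below x).
  have -> : below x = \bigcup_(y in [set y | y < x]) range (F y).
    by apply/seteqP; split=> z [y yx]; [move=> [n <-]; exists y|move=> [n _ <-];
       exists y => //; exists n].
  apply: bigcup_countable => [|y _].
    by apply: sub_countable (omega1_countable_seg x);
      apply: subset_card_le => y /ltW.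
  exact: sub_countable (card_image_le _ _) _.
have Fdisj x y m n : y < x -> F x n <> F y m.
  move=> yx E; have [_ /(_ n)] := freshP _ (cbelow x).
  by rewrite -FE; apply; exists y => //; exists m.
apply/card_leTTP; exists (fun u => F u.1 u.2) => -[x n] [y m] /= E.
case: (ltgtP x y) E => [xy /esym|yx|<-];
  [by move/Fdisj-> || by move=> /Fdisj..|].
by have [+ _] := freshP _ (cbelow x); rewrite -FE => /[apply]->.
Qed.

(** An element is located by the stage at which it appears and by its number in
    an enumeration of that stage. This is the form in which all cardinality
    bounds by aleph_1 are obtained below. *)
Lemma card_le_omega1_rank (T : Type) (rank : T -> omega1) :
  (forall a, countable [set t | rank t <= a]) -> [set: T] #<= [set: omega1].
Proof.
move=> cr; have [code codeP] := choice (fun a => countable_injP _ (cr a)).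
apply: card_le_trans omega1_nat_le; apply/card_leTTP.
exists (fun t => (rank t, code (rank t) t)) => s t [rst].
by rewrite rst; apply: codeP; apply/mem_set; rewrite /= ?rst.
Qed.

Lemma omega1_square_le : [set: omega1 * omega1] #<= [set: omega1].
Proof.
apply: (@card_le_omega1_rank _ (fun u => Order.max u.1 u.2)) => a.
have c := omega1_countable_seg a; apply: sub_countable (countableX c c).
by apply: subset_card_le => -[x y]; rewrite /= ge_max => /andP[].
Qed.

Lemma omega1_seq_le (K : countType) :
  [set: seq (omega1 * K)] #<= [set: omega1].
Proof.
have [o _] := omega1_nonempty.
pose rank (s : seq (omega1 * K)) := foldr (fun u => Order.max u.1) o s.
apply: (@card_le_omega1_rank _ rank) => a.
have c := countableX (omega1_countable_seg a) (countableP [set: K]).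
apply: sub_countable (countable_seq_over c); apply: subset_card_le => s /=.
elim: s => //= -[x k] s IH; rewrite ge_max => /andP[xa /IH{}IH] u.
by rewrite inE => /orP[/eqP-> //|/IH].
Qed.

(** Closing off: starting above any given ordinal, iterate a function dominating
    h; the supremum of the iterates is closed under h. So the ordinals closed
    under h are unbounded. *)
Lemma uncountable_closed (h : omega1 -> omega1) (a0 : omega1) :
  ~ countable [set a | a0 < a /\ forall b, b < a -> h b < a].
Proof.
move=> /omega1_bounded[b0 b0P].
have /choice[up upP] : forall b, exists c, b < c /\ forall x, x <= b -> h x < c.
  move=> b; pose A := b |` (h @` [set x | x <= b]).
  have [|c cP] := @omega1_bounded A.
    rewrite /A -bigcup2E; apply: bigcup_countable => // -[|[|i]] _ //=.
    exact: sub_countable (card_image_le _ _) (omega1_countable_seg b).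
  exists c; split=> [|x xb]; first by apply: cP; left.
  by apply: cP; right; exists x.
pose a n := iter n up (Order.max a0 b0).
have [|c cP] := @omega1_bounded (range a).
  exact: sub_countable (card_image_le _ _) _.
have [|z zP zmin] := @omega1_wf [set z | forall n, a n < z].
  by exists c => n; apply: cP; exists n.
have [az bz] : a0 < z /\ b0 < z by have := zP 0%N; rewrite /= gt_max => /andP.
have : z < b0.
  apply: b0P; split=> // b {}bz; have [n] : exists n, b <= a n.
    apply: contrapT => /forallNP nb; have := zmin b; rewrite leNgt bz => H.
    suff: false by []; apply: H => n; rewrite ltNge; exact/negP/nb.
  by move=> /(upP _).2 /lt_trans; apply; apply: (zP n.+1).
by move=> /(lt_trans bz); rewrite ltxx.
Qed.
End Omega1.

Local Open Scope ring_scope.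
Local Open Scope quotient_scope.

(** * Rational numbers modulo the integers *)

Lemma integral_zmod_closed : zmod_closed (fun x : rat => x \is a Num.int).
Proof. by split=> [|x y]; [exact: rpred0|exact: rpredB]. Qed.

Definition integral : zmodClosed rat :=
  HB.pack (fun x : rat => x \is a Num.int)
    (GRing.isZmodClosed.Build rat _ integral_zmod_closed).

Local Notation rat_mod_int := (Quotient.quot integral).

Definition QZ : zmodType := rat_mod_int.

Definition mod_int : {additive rat -> QZ} := \pi_rat_mod_int.

Lemma mod_int_surj (x : QZ) : exists r, mod_int r = x.
Proof. by exists (repr (x : rat_mod_int)); rewrite /mod_int /= reprK. Qed.

Lemma mod_int_eq0 r : (mod_int r == 0) = (r \is a Num.int).
Proof.
by rewrite -(raddf0 mod_int) /mod_int /= piE Quotient.equivE subr0 unfold_in.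
Qed.

Lemma QZ_countable : countable [set: QZ].
Proof.
apply: sub_countable (countableP [set: rat]).
apply: card_le_trans (card_image_le mod_int _); apply: subset_card_le => x _.
by have [r <-] := mod_int_surj x; exists r.
Qed.

Lemma QZ_divisible (n : nat) (x : QZ) : (0 < n)%N -> exists y : QZ, y *+ n = x.
Proof.
move=> n0; have [r <-] := mod_int_surj x; exists (mod_int (r / n%:R)).
rewrite -raddfMn /= -(mulr_natr (r / _)) mulfVK //.
by rewrite Num.Theory.pnatr_eq0 -lt0n.
Qed.

(** The class of 1/p^m, of order p^m. These compatible elements stand for
    generators of all the finite cyclic p-groups inside a single divisible
    group. *)
Definition proot (p m : nat) : QZ := mod_int (p ^ m)%N%:R^-1.

Lemma proot_order p m n : (0 < p)%N ->
  (proot p m *+ n == 0) = (p ^ m %| n)%N.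
Proof.
move=> p0; have q0 : (p ^ m)%N%:R != 0 :> rat.
  by rewrite Num.Theory.pnatr_eq0 -lt0n expn_gt0 p0.
rewrite -raddfMn mod_int_eq0 -(mulr_natl (_^-1)).
apply/idP/idP => [/Num.Theory.intrP[z zE]|/dvdnP[c ->]]; last first.
  by rewrite natrM mulfK // rpred_nat.
have : n%:R = z%:~R * (p ^ m)%N%:R :> rat by rewrite -zE mulfVK.
rewrite !pmulrn -intrM => /intr_inj nE.
by have := dvdz_mull z (dvdzz (p ^ m)%N); rewrite -nE dvdzE.
Qed.

Lemma proot1_neq0 p : prime p -> proot p 1 <> 0.
Proof.
move=> p_prime; apply/eqP; rewrite -[proot p 1]mulr1n proot_order ?prime_gt0 //.
by rewrite expn1 dvdn1 neq_ltn prime_gt1 ?orbT.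
Qed.

Lemma prootS p m : (0 < p)%N -> proot p m.+1 *+ p = proot p m.
Proof.
move=> p0; have q0 : p%:R != 0 :> rat by rewrite Num.Theory.pnatr_eq0 -lt0n.
rewrite -raddfMn /proot expnSr natrM invfM -(mulr_natr (_ * _)).
by rewrite mulfVK.
Qed.

(** * Subgroups, homomorphisms and torsion *)

Section SubgroupType.
Variables (V : zmodType) (H : zmodClosed V).

Definition subgroup_type := {x : V | x \in H}.
HB.instance Definition _ := [isSub of subgroup_type for val].
HB.instance Definition _ := [Choice of subgroup_type by <:].
HB.instance Definition _ := [SubChoice_isSubZmodule of subgroup_type by <:].
End SubgroupType.

(** The groups built below are cut out of groups of functions by classical
    predicates; this turns such a subset into a group in its own right. *)
Lemma subgroup_as_group (V : zmodType) (A : set V) :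
  zmod_closed (fun x => x \in A) ->
  exists (W : zmodType) (i : {additive W -> V}), injective i /\ range i = A.
Proof.
move=> cA; pose m := GRing.isZmodClosed.Build V (fun x => x \in A) cA.
pose H : zmodClosed V := HB.pack (fun x : V => x \in A) m.
exists (subgroup_type H), (\val : {additive subgroup_type H -> V}).
split; first exact: val_inj.
apply/seteqP; split=> [_ [x _ <-]|x Ax]; first by have /set_mem := valP x.
by exists (exist _ x (mem_set Ax : x \in H)).
Qed.

Lemma additive_of_add (V W : zmodType) (f : V -> W) :
  (forall x y, f (x + y) = f x + f y) -> exists g : {additive V -> W}, g =1 f.
Proof.
move=> fD; have fB : zmod_morphism f.
  by move=> x y; apply: (addIr (f y)); rewrite -fD !subrK.
pose g : {additive V -> W} := HB.pack f (GRing.isZmodMorphism.Build V W f fB).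
by exists g.
Qed.

Lemma pair_mulrn (V W : zmodType) (v : V) (w : W) n :
  (v, w) *+ n = (v *+ n, w *+ n).
Proof. by elim: n => // n IH; rewrite !mulrS IH. Qed.

Lemma inverse_mod_power p u k : (0 < u)%N -> coprime p u ->
  exists v w, (u * v = w * p ^ k + 1)%N.
Proof.
move=> u0 pu; have [v w vw _] := egcdnP (p ^ k) u0; exists v, w.
rewrite mulnC vw; congr addn; apply/eqP.
by rewrite -/(coprime _ _) coprime_sym coprimeXl.
Qed.

Section Torsion.
Variables (p : nat) (p_prime : prime p) (G : zmodType).
Implicit Types (x : G).

(** The order of an element of a p-group is a power of p, recorded by its
    exponent e; the equivalence below is the form in which it is used. *)
Lemma order_exponent x m : x *+ p ^ m = 0 ->
  exists e, forall n, (x *+ n == 0) = (p ^ e %| n)%N.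
Proof.
move=> xm; have ex : exists m, x *+ p ^ m == 0 by exists m; rewrite xm.
pose e := ex_minn ex; exists e => n; rewrite /e;
  case: ex_minnP => {}e /eqP xe emin.
have E : x *+ gcdn n (p ^ e) == 0 <-> x *+ n == 0.
  split=> [/eqP E|/eqP E].
    by rewrite -[n](divnK (dvdn_gcdl n (p ^ e))) mulnC mulrnA E mul0rn.
  have [n0|n0] := posnP n; first by rewrite n0 gcd0n xe.
  have [u v uv _] := egcdnP (p ^ e) n0.
  suff: x *+ (u * n) == 0.
    by rewrite uv mulrnDr [(v * _)%N]mulnC mulrnA xe mul0rn add0r.
  by rewrite mulnC mulrnA E mul0rn.
apply/idP/idP => [/E|/dvdnP[c ->]]; last by rewrite mulnC mulrnA xe mul0rn.
have := dvdn_gcdl n (p ^ e).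
have /(dvdn_pfactor _ _ p_prime)[f fe ->] := dvdn_gcdr n (p ^ e).
by move=> pfn /emin ef; rewrite (_ : e = f) //; apply/eqP;
  rewrite eqn_leq ef fe.
Qed.

Lemma abelian_p_groupP :
  abelian_p_group p G <-> forall x, exists m, x *+ p ^ m = 0.
Proof.
split=> [pG x|tG x _].
  have [->|/eqP/pG[n [_ xn _]]] := eqVneq x 0; last by exists n.
  by exists 0%N; rewrite mul0rn.
have [m /order_exponent[e eP]] := tG x; exists e; split.
- by rewrite expn_gt0 prime_gt0.
- by apply/eqP; rewrite eP.
- by move=> k k0 /eqP; rewrite eP => /dvdn_leq; exact.
Qed.
End Torsion.

(** * Coordinates of a p-group along a p-basis *)

Lemma chain_seq (T : eqType) (F : set (set T)) (s : seq T) :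
  total_on F subset -> (forall x, x \in s -> (\bigcup_(A in F) A) x) ->
  s = [::] \/ exists2 A, F A & forall x, x \in s -> A x.
Proof.
move=> totF; elim: s => [|x s IH] xsF; [by left|right].
have [A FA Ax] := xsF x (mem_head x s).
have [|->|[B FB sB]] := IH.
- by move=> y ys; apply: xsF; rewrite inE ys orbT.
- by exists A => // y; rewrite inE => /eqP->.
have [AB|BA] := totF A B FA FB.
  by exists B => // y; rewrite inE => /orP[/eqP->|/sB//]; exact: AB.
by exists A => // y; rewrite inE => /orP[/eqP->//|/sB]; exact: BA.
Qed.

Section Coordinates.
Variables (p : nat) (p_prime : prime p) (G : zmodType) (e : G -> nat).
Hypothesis eP : forall x n, (x *+ n == 0) = (p ^ e x %| n)%N.
Implicit Types (a x z : G) (s t : seq G) (X : set G).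

Let p_gt0 : (0 < p)%N := prime_gt0 p_prime.

Definition drawn_from X s := forall x, x \in s -> X x.

(** A finite sum of elements of X is written as a sequence with repetitions, the
    coefficient of x being its multiplicity: in a torsion group nonnegative
    coefficients suffice. The condition says that such a sum is divisible by
    p^k only when every one of its terms visibly is, either because p^k divides
    the coefficient or because the term vanishes; equivalently, the nonzero
    elements of X form a basis of a pure subgroup that is a direct sum of cyclic
    groups. The exponent minn k (e x) covers both cases. *)
Definition p_independent X := forall s k z, drawn_from X s ->
  \sum_(x <- s) x = z *+ p ^ k ->
  forall x, (p ^ minn k (e x) %| count_mem x s)%N.

Definition combination_mod X k a :=
  exists s z, drawn_from X s /\ a = \sum_(x <- s) x + z *+ p ^ k.

Lemma drawn_from_cat X s t :
  drawn_from X s -> drawn_from X t -> drawn_from X (s ++ t).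
Proof. by move=> Xs Xt x; rewrite mem_cat => /orP[/Xs|/Xt]. Qed.

Lemma combination_mul X s c : drawn_from X s -> exists2 t, drawn_from X t &
  \sum_(x <- t) x = (\sum_(x <- s) x) *+ c
  /\ forall x, count_mem x t = (count_mem x s * c)%N.
Proof.
move=> Xs; elim: c => [|c [t Xt [sumt ct]]].
  by exists [::] => //; rewrite big_nil mulr0n; split=> // x; rewrite muln0.
exists (s ++ t); first exact: drawn_from_cat.
by rewrite big_cat /= sumt mulrS; split=> // x; rewrite count_cat ct mulnS.
Qed.

Lemma combination_opp X s : drawn_from X s -> exists2 t, drawn_from X t &
  \sum_(x <- t) x = - \sum_(x <- s) x
  /\ forall x, (p ^ e x %| count_mem x s + count_mem x t)%N.
Proof.
move=> Xs; have [m mP] : exists m, forall x, x \in s -> (p ^ e x %| p ^ m)%N.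
  elim: (s) => [|x r [m mP]]; first by exists 0%N.
  exists (maxn (e x) m) => y; rewrite inE => /orP[/eqP->|/mP /dvdn_trans-> //].
    exact: dvdn_exp2l (leq_maxl _ _).
  exact: dvdn_exp2l (leq_maxr _ _).
have pm : (p ^ m).-1.+1 = (p ^ m)%N by rewrite prednK // expn_gt0 p_gt0.
have [t Xt [sumt ct]] := combination_mul (p ^ m).-1 Xs.
exists t => //; split=> [|x]; last first.
  rewrite ct addnC -mulnSr pm; have [/mP|xs] := boolP (x \in s).
    exact: dvdn_mull.
  by rewrite (count_memPn xs) mul0n dvdn0.
apply/eqP; rewrite -addr_eq0 sumt -mulrSr pm -sumrMnl big_seq big1 // => x xs.
by apply/eqP; rewrite eP mP.
Qed.

(** Divisibility of every coefficient gives divisibility of the sum inside the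
    subgroup generated by X: terms whose order divides p^j are dropped and the
    other coefficients are divided. *)
Lemma combination_div X s j : drawn_from X s ->
  (forall x, (p ^ minn j (e x) %| count_mem x s)%N) ->
  exists2 t, drawn_from X t & \sum_(x <- s) x = (\sum_(x <- t) x) *+ p ^ j.
Proof.
move=> Xs dvds.
have -> : \sum_(x <- s) x = \sum_(x <- undup s) x *+ count_mem x s.
  rewrite -(big_undup_iterop_count _ s xpredT id).
  by apply: eq_bigr.
have : {subset undup s <= s} by move=> x; rewrite mem_undup.
elim: (undup s) => [|x r IH] rs; first by exists [::]; rewrite ?big_nil ?mul0rn.
have [|t Xt rt] := IH; first by move=> y yr; apply: rs; rewrite inE yr orbT.
have Xx : X x by apply: Xs; apply: rs; exact: mem_head.
rewrite big_cons rt.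
have [je|/ltnW ej] := leqP j (e x).
  have := dvds x; rewrite (minn_idPl je) => /dvdnP[c ->].
  exists (nseq c x ++ t); first by apply: drawn_from_cat => // y /nseqP[->].
  by rewrite big_cat /= big_nseq iter_addr_0 mulrnDl mulrnA.
have := dvds x; rewrite (minn_idPr ej) -eP => /eqP->.
by exists t; rewrite ?add0r.
Qed.

Lemma p_independent_chain (F : set (set G)) : F `<=` p_independent ->
  total_on F subset -> p_independent (\bigcup_(X in F) X).
Proof.
move=> Find totF s k z /(chain_seq totF)[-> _ x|[X FX Xs]]; first exact: dvdn0.
exact: Find FX s k z Xs.
Qed.

(** If some a were outside the span of X modulo p, take one of least order.
    Suppose that X with a added were not p-independent. Then, for some j below
    both k and the exponent of a, p^j a would agree modulo p^k G with an element
    of the span of X, and that element is itself p^j b with b in the span. Hence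
    a differs from an element of order at most p^j by a member of the span
    modulo p, and that element contradicts the minimality. *)
Lemma maximal_spans X : p_independent X ->
  (forall Y, X `<` Y -> ~ p_independent Y) -> forall a, combination_mod X 1 a.
Proof.
move=> indX maxX a; have [m] := ubnP (e a); elim: m a => // m IH a.
rewrite ltnS => em; apply: contrapT => nspan.
have nXa : ~ X a.
  move=> Xa; apply: nspan; exists [:: a], 0.
  by rewrite big_seq1 mul0rn addr0; split=> // x; rewrite inE => /eqP->.
apply: (maxX (a |` X)); first by split=> [x Xx|aX]; [right|apply/nXa/aX; left].
move=> s k z Xs sumE.
pose n := count_mem a s; pose s1 := [seq x <- s | x != a].
have Xs1 : drawn_from X s1.
  by move=> x; rewrite mem_filter => /andP[/= /eqP xa /Xs[]].
have sE : \sum_(x <- s) x = a *+ n + \sum_(x <- s1) x.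
  rewrite (bigID (pred1 a)) /= big_filter; congr (_ + _).
  rewrite (eq_bigr (fun=> a)) => [|x /eqP//].
  by rewrite big_const_seq iter_addr_0.
have [dvdn|ndvdn] := boolP (p ^ minn k (e a) %| n)%N.
  have [y yE] : exists y, a *+ n = y *+ p ^ k.
    have [ke|/ltnW ek] := leqP k (e a).
      move: dvdn; rewrite (minn_idPl ke) => /dvdnP[c ->].
      by exists (a *+ c); rewrite mulrnA.
    by move: dvdn; rewrite (minn_idPr ek) -eP => /eqP->; exists 0;
      rewrite mul0rn.
  move=> x; have [->//|xa] := eqVneq x a.
  have -> : count_mem x s = count_mem x s1.
    rewrite count_filter; apply: eq_count => i /=.
    by have [->|] := eqVneq i x; rewrite ?xa.
  apply: (indX s1 k (z - y)) => //.
  by apply: (@addrI _ (a *+ n)); rewrite -sE sumE mulrnBl yE addrC subrK.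
have n0 : (0 < n)%N.
  by rewrite lt0n; apply: contraNneq ndvdn => ->; exact: dvdn0.
have [u pu nE] := pfactor_coprime p_prime n0; set j := logn p n in nE.
have jke : (j < minn k (e a))%N.
  rewrite ltnNge; apply: contra ndvdn => /(dvdn_exp2l p) /dvdn_trans; apply.
  by rewrite nE dvdn_mull.
have [jk je] : (j < k)%N /\ (j < e a)%N.
  by move: jke; rewrite leq_min => /andP[].
have u0 : (0 < u)%N by move: n0; rewrite nE muln_gt0 => /andP[].
(* n = u p^j, and multiplying by the inverse v of u reduces n to p^j. *)
have [v [w vw]] := inverse_mod_power (e a) u0 pu.
have [s2 Xs2 [sum2 _]] := combination_mul v Xs1.
have E : \sum_(x <- s2) x = (z *+ v *+ p ^ (k - j) - a) *+ p ^ j.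
  rewrite mulrnBl -mulrnA -expnD subnK 1?ltnW // sum2.
  have -> : a *+ p ^ j = a *+ n *+ v.
    rewrite nE -mulrnA mulnAC vw mulnDl mul1n mulrnDr mulnAC mulnC mulrnA.
    have /eqP-> : a *+ p ^ e a == 0 by rewrite eP.
    by rewrite mul0rn add0r.
  by rewrite mulrnAC -sumE sE mulrnDl addrAC subrr add0r.
(* The sum over s3 plus a - z v p^(k - j) is killed by p^j, and j < e a. *)
have [s3 Xs3 sum3] := combination_div Xs2 (indX _ _ _ Xs2 E).
have /IH[] : (e (\sum_(x <- s3) x + (a - z *+ v *+ p ^ (k - j))) < m)%N.
  apply: leq_trans em; apply: leq_ltn_trans je.
  rewrite -(@dvdn_Pexp2l p) ?prime_gt1 // -eP mulrnDl -sum3 E -mulrnDl.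
  by rewrite addrA subrK subrr mul0rn.
move=> t [y [Xt aE]]; exfalso; apply: nspan.
have [s4 Xs4 [sum4 _]] := combination_opp Xs3.
exists (t ++ s4), (y + z *+ v *+ p ^ (k - j).-1); split;
  first exact: drawn_from_cat.
rewrite mulrnDl big_cat /= sum4 addrACA -aE.
rewrite -(mulrnA _ (p ^ _)) -expnD addn1 prednK ?subn_gt0 //.
by rewrite addrACA subrr add0r subrK.
Qed.

Lemma combination_mod_all X : (forall a, combination_mod X 1 a) ->
  forall k a, combination_mod X k a.
Proof.
move=> spanX; elim=> [|k IH] a.
  by exists [::], a; rewrite big_nil add0r.
have [s [z [Xs ->]]] := IH a; have [t [y [Xt ->]]] := spanX z.
have [r Xr [sumr _]] := combination_mul (p ^ k) Xt.
exists (s ++ r), y; split; first exact: drawn_from_cat.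
by rewrite big_cat /= sumr mulrnDl -mulrnA -expnD addrA.
Qed.

(** In an expression of an element modulo p^k the coefficient of x is unique
    modulo the smaller of p^k and p^(e x), as the difference of two expressions
    shows by p-independence. The factor p^(e x - k) makes this an equation. *)
Lemma combination_count X s t z y k x : p_independent X ->
  drawn_from X s -> drawn_from X t ->
  \sum_(x <- s) x + z *+ p ^ k = \sum_(x <- t) x + y *+ p ^ k ->
  proot p (e x) *+ count_mem x s *+ p ^ (e x - k)
    = proot p (e x) *+ count_mem x t *+ p ^ (e x - k).
Proof.
move=> indX Xs Xt E; have [t' Xt' [sumt' ct']] := combination_opp Xt.
have Est' : \sum_(x <- s ++ t') x = (y - z) *+ p ^ k.
  rewrite big_cat /= sumt' mulrnBl; apply/eqP.
  by rewrite subr_eq addrAC eq_sym subr_eq addrC -E.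
have := indX _ _ _ (drawn_from_cat Xs Xt') Est' x; rewrite count_cat => dvd1.
have root0 c : (p ^ minn k (e x) %| c)%N ->
    proot p (e x) *+ c *+ p ^ (e x - k) = 0.
  move=> dvdc; apply/eqP; rewrite -mulrnA proot_order //.
  have {1}-> : e x = (minn k (e x) + (e x - k))%N by lia.
  by rewrite expnD dvdn_mul.
apply: (@addIr _ (proot p (e x) *+ count_mem x t' *+ p ^ (e x - k))).
rewrite -!mulrnDl -!mulrnDr !root0 //.
by apply: dvdn_trans (ct' x); rewrite dvdn_exp2l // geq_minr.
Qed.

End Coordinates.

(** Coordinates along a maximal p-independent set. As that set spans G modulo
    every p^k, the coefficient of x in an element a can be read off modulo the
    order p^(e x) of x, and c x a is this coefficient times a fixed element of
    order p^(e x). The coordinate is divisible by p^k in the cyclic group of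
    order p^(e x) exactly when p^(e x - k) kills it, the truncated subtraction
    covering the case k > e x. An expression of a modulo p^k has finitely many
    terms, hence the third clause; and if all its coefficients are divisible
    then so is a, hence the last. *)
Theorem torsion_coordinates (p : nat) (G : zmodType) : prime p ->
  (forall x : G, exists m, x *+ p ^ m = 0) ->
  exists (e : G -> nat) (c : G -> {additive G -> QZ}),
  [/\ forall x n, (x *+ n == 0) = (p ^ e x %| n)%N,
      forall x a, c x a *+ p ^ e x = 0,
      forall a k, finite_set [set x | c x a *+ p ^ (e x - k) <> 0]
    & forall a k, (forall x, c x a *+ p ^ (e x - k) = 0) ->
        exists z, a = z *+ p ^ k].
Proof.
move=> p_prime tG; have p0 := prime_gt0 p_prime.
have /choice[e eP] : forall x : G, exists e, forall n,
    (x *+ n == 0) = (p ^ e %| n)%N.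
  move=> x; have [m xm] := tG x; exact (order_exponent p_prime xm).
have [X [indX maxX]] := Zorn_bigcup (@p_independent_chain p G e).
have spanX := combination_mod_all (maximal_spans p_prime eP indX maxX).
have /choice[S SP] : forall xa : G * G, exists s,
    drawn_from X s /\ exists z, xa.2 = \sum_(x <- s) x + z *+ p ^ e xa.1.
  by move=> [x a]; have [s [z [Xs aE]]] := spanX (e x) a; exists s; split=> //;
    exists z.
pose c x a := proot p (e x) *+ count_mem x (S (x, a)).
have ck x a : c x a *+ p ^ e x = 0.
  by apply/eqP; rewrite mulrnAC -mulrnA proot_order // dvdn_mulr.
have cE x a s z k : drawn_from X s -> a = \sum_(x <- s) x + z *+ p ^ k ->
    c x a *+ p ^ (e x - k) = proot p (e x) *+ count_mem x s *+ p ^ (e x - k).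
  move=> Xs aE; have [/= Xt [y aE']] := SP (x, a).
  (* Of the two expressions of a, one modulo p^k and the other modulo p^(e x),
     both are expressions modulo the smaller power. *)
  pose j := minn k (e x).
  have -> : (e x - k = e x - j)%N by rewrite /j; lia.
  rewrite /c; apply: (combination_count (k := j) p_prime eP
    (y := z *+ p ^ (k - j)) (z := y *+ p ^ (e x - j)) x indX) => //.
  by rewrite -!mulrnA -!expnD !subnK ?geq_minl ?geq_minr // -aE.
have /choice[d dc] : forall x, exists d : {additive G -> QZ}, d =1 c x.
  move=> x; apply: additive_of_add => a b; have [/= Xs [z aE]] := SP (x, a).
  have [/= Xt [y bE]] := SP (x, b).
  have := @cE x (a + b) (S (x, a) ++ S (x, b)) (z + y) (e x).
  rewrite subnn expn0 !mulr1n count_cat mulrnDr => -> //;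
    first exact: drawn_from_cat.
  by rewrite {1}aE {1}bE big_cat /= mulrnDl addrACA.
exists e, d; split=> [//|x a|a k|a k].
- by rewrite dc.
- have [s [z [Xs aE]]] := spanX k a.
  apply: sub_finite_set (finite_seq s) => x /=; apply: contra_notT => xs.
  by rewrite dc (cE _ _ _ _ _ Xs aE) (count_memPn xs) mul0rn.
- move=> a0; have [s [z [Xs aE]]] := spanX k a.
  have [x|t Xt sumt] := combination_div (j := k) eP Xs.
    have := a0 x; rewrite dc (cE _ _ _ _ _ Xs aE) -mulrnA => /eqP.
    have e_split : e x = (minn k (e x) + (e x - k))%N by lia.
    by rewrite proot_order // {1}e_split expnD dvdn_pmul2r // expn_gt0 p0.
  by exists (\sum_(x <- t) x + z); rewrite aE sumt -mulrnDl.
Qed.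

(** * Extension of homomorphisms to divisible groups *)

Section Subgroups.
Variable V : zmodType.
Implicit Types (A : set V) (x y : V).

Definition subgroup A := A 0 /\ forall x y, A x -> A y -> A (x - y).

Lemma subgroup_zmod_closed A : subgroup A -> zmod_closed (fun x => x \in A).
Proof.
move=> [A0 AB]; split=> [|x y]; first exact: mem_set.
by move=> /set_mem Ax /set_mem Ay; apply: mem_set; exact: AB.
Qed.

Lemma subgroupN A x : subgroup A -> A x -> A (- x).
Proof. by move=> [A0 AB] Ax; rewrite -sub0r; exact: AB. Qed.

Lemma subgroupD A x y : subgroup A -> A x -> A y -> A (x + y).
Proof.
move=> sA Ax Ay; rewrite -(opprK y); apply: sA.2 => //; exact: subgroupN.
Qed.

Lemma subgroupMn A x n : subgroup A -> A x -> A (x *+ n).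
Proof.
move=> sA Ax; elim: n => [|n IH]; first exact: sA.1.
by rewrite mulrS; exact: subgroupD.
Qed.

Lemma subgroupMz A x (n : int) : subgroup A -> A x -> A (x *~ n).
Proof.
move=> sA Ax; case: n => n; first exact: subgroupMn.
by apply: subgroupN => //; exact: subgroupMn.
Qed.
End Subgroups.

Lemma subgroup_torsion (p : nat) (V : zmodType) :
  subgroup [set x : V | exists m, x *+ p ^ m = 0].
Proof.
split=> [|x y [m xm] [n yn]]; first by exists 0%N.
exists (m + n)%N; rewrite mulrnBl expnD mulrnA xm mul0rn sub0r.
by rewrite mulnC mulrnA yn mul0rn oppr0.
Qed.

Section Extension.
Variables (p : nat) (p_prime : prime p) (G V : zmodType) (E : set V).
Hypothesis tG : forall x : G, exists m, x *+ p ^ m = 0.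
Hypothesis sE : subgroup E.
Hypothesis divE : forall v, E v -> exists2 w, E w & w *+ p = v.
Implicit Types (A B : set (G * V)).

(** The graph of a homomorphism from a subgroup of G to E; for a subgroup of the
    product, single-valuedness need only be checked at 0. *)
Definition partial_hom A :=
  [/\ subgroup A, forall v, A (0, v) -> v = 0 & forall u, A u -> E u.2].

(** The members of F are enlarged by A0 so that the empty chain, too, has an
    upper bound containing A0. *)
Lemma partial_hom_chain A0 (F : set (set (G * V))) : partial_hom A0 ->
  (forall A, F A -> partial_hom (A `|` A0)) -> total_on F subset ->
  partial_hom (\bigcup_(A in F) A `|` A0).
Proof.
move=> hA0 hF totF; set W := _ `|` A0.
have pairP u v : W u -> W v ->
    exists B, [/\ partial_hom B, B u, B v & B `<=` W].
  have sub A : F A -> A `|` A0 `<=` W.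
    by move=> FA w [Aw|]; [left; exists A|right].
  move=> [[A FA Au]|A0u] [[B FB Bv]|A0v].
  - have [AB|BA] := totF A B FA FB.
      by exists (B `|` A0); split; [exact: hF|left; exact: AB|left|exact: sub].
    by exists (A `|` A0); split; [exact: hF|left|left; exact: BA|exact: sub].
  - by exists (A `|` A0); split; [exact: hF|left|right|exact: sub].
  - by exists (B `|` A0); split; [exact: hF|right|left|exact: sub].
  - by exists A0; split=> // w; right.
have W0 : W 0 by right; case: hA0 => -[].
split; first split=> // u v Wu Wv.
- have [B [[[_ BB] _ _] Bu Bv BW]] := pairP u v Wu Wv.
  by apply: BW; exact: BB.
- by move=> v Wv; have [B [[_ + _] Bv _ _]] := pairP _ _ Wv Wv; apply.
- by move=> u Wu; have [B [[_ _ +] Bu _ _]] := pairP _ _ Wu Wu; apply.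
Qed.

(** Send a to some b with p b = v. Single-valuedness: a multiple n a lies in the
    domain only if p divides n, for otherwise a itself would lie in it by a
    Bezout relation between n and p. *)
Lemma partial_hom_step A a v : partial_hom A -> A (a *+ p, v) ->
  (forall w, ~ A (a, w)) ->
  exists B, [/\ partial_hom B, A `<=` B & exists w, B (a, w)].
Proof.
move=> [sA funA AE] Apv aA; have [b Eb /= bp] := divE (AE _ Apv).
exists [set u | exists w (n : int), A w /\ u = w + (a, b) *~ n]; split;
  last 2 first.
- by move=> w Aw; exists w, 0; rewrite mulr0z addr0.
- by exists b, 0, 1; rewrite mulr1z add0r; split=> //; exact: sA.1.
have Apab : A ((a, b) *~ p%:Z).
  suff -> : (a, b) *~ p%:Z = (a *+ p, v) by [].
  by rewrite -bp -pmulrn; elim: (p) => // n IH; rewrite !mulrS IH.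
have snd_mul (n : int) : ((a, b) *~ n).2 = b *~ n.
  by rewrite (raddfMz (snd : {additive (G * V)%type -> V})).
have fst_mul (u : G * V) (n : int) : (u *~ n).1 = u.1 *~ n :> G.
  by rewrite (raddfMz (fst : {additive (G * V)%type -> G})).
split; first split.
- by exists 0, 0; rewrite mulr0z addr0; split=> //; exact: sA.1.
- move=> _ _ [u [m [Au ->]]] [w [n [Aw ->]]]; exists (u - w), (m - n).
  by split; [exact: sA.2|rewrite mulrzBr opprD addrACA].
- move=> c [w [n [Aw cE]]]; have [pn|pn] := boolP (p %| n)%Z.
    apply: funA; rewrite cE; apply: subgroupD => //.
    by case/dvdzP: pn => q ->; rewrite mulrC mulrzA; exact: subgroupMz.
  have : coprimez n p.
    by rewrite coprimez_sym coprimezE prime_coprime.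
  move=> /coprimezP[[s t] /= st]; exfalso.
  have /(congr1 fst) /= := cE; rewrite fst_mul => /eqP;
    rewrite eq_sym addrC addr_eq0 => /eqP na.
  have := subgroupD sA
    (subgroupMz s sA (subgroupN sA Aw)) (subgroupMz t sA Apab).
  rewrite [X in A X]surjective_pairing /= !fst_mul /= -na.
  rewrite -!mulrzA [n * s]mulrC [p%:Z * t]mulrC -mulrzDr st mulr1z.
  exact: aA.
- move=> _ [w [n [Aw ->]]] /=; rewrite snd_mul.
  by apply: subgroupD => //; [exact: AE|exact: subgroupMz].
Qed.

(** Divisible groups are injective. For a p-group G divisibility by p suffices:
    if the domain of a maximal partial homomorphism missed an element, it would
    miss some a with p a in it. *)
Lemma divisible_extension A0 : partial_hom A0 ->
  exists f : {additive G -> V},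
    (forall x, E (f x)) /\ (forall x v, A0 (x, v) -> f x = v).
Proof.
move=> hA0; have [|A [hA maxA]] :=
  @Zorn_bigcup _ [set A | partial_hom (A `|` A0)].
  by move=> F FP totF; exact: partial_hom_chain.
set B := A `|` A0 in hA.
have maxB C : partial_hom C -> B `<=` C -> C `<=` B.
  move=> hC BC u Cu; apply: contrapT => nBu; apply: (maxA C).
    split=> [w Aw|CA]; first by apply: BC; left.
    by apply: nBu; left; exact: CA.
  by rewrite /= setUidl // => w A0w; apply: BC; right.
have domB x : exists v, B (x, v).
  have [m] := tG x; elim: m x => [|m IH] x.
    by rewrite mulr1n => ->; exists 0; case: hA => -[].
  rewrite expnS mulrnA => /IH[v Bv].
  apply: contrapT => /forallNP nB.
  have [C [hC BC [w Cw]]] := partial_hom_step hA Bv nB.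
  by apply: (nB w); exact: maxB Cw.
have [f fP] := choice domB; case: hA => sB funB BE.
have funB2 x v w : B (x, v) -> B (x, w) -> v = w.
  move=> Bv Bw; apply/eqP; rewrite -subr_eq0; apply/eqP/funB.
  by have := sB.2 _ _ Bv Bw; rewrite -[_ - _]/(x - x, v - w) subrr.
have [|g gf] := @additive_of_add G V f.
  by move=> x y; apply: funB2 (fP _) _; exact: (subgroupD sB (fP x) (fP y)).
exists g; split=> [x|x v A0v]; rewrite gf; first exact: BE (fP x).
by apply: funB2 (fP _) _; right.
Qed.
End Extension.

(** * Embedding into a direct sum of copies of QZ *)

Lemma partial_inverse (A B : Type) (f : A -> B) : injective f ->
  exists g : B -> option A, pcancel f g /\ ocancel g f.
Proof.
move=> finj; have /choice[g gP] : forall b, exists o : option A,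
    if o is Some a then f a = b else forall a, f a <> b.
  move=> b; have [[a ab]|nb] := pselect (exists a, f a = b);
    first by exists (Some a).
  by exists None => a ab; apply: nb; exists a.
exists g; split=> [a|b]; last by have := gP b; case: (g b).
by have := gP (f a); case: (g (f a)) => [a' /finj->|/(_ a)].
Qed.

(** Extension by zero along an injection with partial inverse g. *)
Definition reindex (A B : Type) (g : B -> option A) (f : A -> QZ) : B -> QZ :=
  fun b => if g b is Some a then f a else 0.

Lemma additive_reindex (G : zmodType) (A B : Type) (g : B -> option A)
    (c : A -> {additive G -> QZ}) :
  exists F : {additive G -> B -> QZ}, forall x,
    F x = reindex g (fun a => c a x).
Proof.
apply: additive_of_add => x y; apply/funext => b;
  rewrite /reindex -[RHS]/(_ + _).
by case: (g b) => [a|]; rewrite ?raddfD ?addr0.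
Qed.

Definition support (J : Type) (f : J -> QZ) : set J := [set j | f j <> 0].

Lemma finite_support_reindex (A B : Type) (h : A -> B) g (f : A -> QZ) :
  ocancel g h -> finite_set (support f) -> finite_set (support (reindex g f)).
Proof.
move=> gK /(finite_image h); apply: sub_finite_set => b;
  rewrite /support /reindex /=.
by have := gK b; case: (g b) => //= a ab fa; exists a.
Qed.

Lemma subgroup_finite_support (J : Type) :
  subgroup [set f : J -> QZ | finite_set (support f)].
Proof.
split=> [|f g fin_f fin_g] /=.
  by rewrite (_ : support _ = set0) //; apply/seteqP; split=> j.
apply: (@sub_finite_set _ _ (support f `|` support g));
  last by rewrite finite_setU.
move=> j fgj /=; apply: contrapT => /not_orP[/contrapT fj /contrapT gj].
apply: fgj; rewrite -[(f - g) j]/(f j - g j) fj gj; exact: subrr.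
Qed.

Lemma finite_support_divisible (J : Type) (p : nat) (f : J -> QZ) : (0 < p)%N ->
  finite_set (support f) -> exists2 g, finite_set (support g) & g *+ p = f.
Proof.
move=> p0 fin_f.
have /choice[g gP] : forall j, exists v : QZ,
  v *+ p = f j /\ (f j = 0 -> v = 0).
  move=> j; have [->|fj] := pselect (f j = 0).
    by exists 0; rewrite mul0rn.
  by have [v vp] := QZ_divisible (f j) p0; exists v.
exists g; last by rewrite natmulfctE; apply/funext => j; have [] := gP j.
by apply: sub_finite_set fin_f => j gj fj; apply: gj; apply: (gP j).2.
Qed.

Section Embeddings.
Variables (p : nat) (p_prime : prime p) (G : zmodType).
Hypothesis tG : forall x : G, exists m, x *+ p ^ m = 0.

Let p_gt0 : (0 < p)%N := prime_gt0 p_prime.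

(** The coordinates of the socle G[p] embed it in a direct sum of copies of QZ.
    Divisibility extends this embedding to G, and the extension is injective
    because every nonzero subgroup of G meets the socle. *)
Lemma divisible_embedding (J : Type) (h : G -> J) : injective h ->
  exists f : {additive G -> J -> QZ},
    injective f /\ forall x, finite_set (support (f x)).
Proof.
move=> hinj; have sub_socle : subgroup [set x : G | x *+ p = 0].
  by split=> [|x y /= xp yp]; rewrite /= ?mul0rn // mulrnBl xp yp subrr.
have [S [i [iinj iE]]] := subgroup_as_group (subgroup_zmod_closed sub_socle).
have Sp (w : S) : w *+ p = 0.
  apply: iinj; rewrite raddfMn raddf0.
  suff : range i (i w) by rewrite iE.
  by exists w.
have [|e [c [eP _ cfin c0]]] := @torsion_coordinates p S p_prime.
  by move=> w; exists 1%N; rewrite expn1.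
have e1 w : (e w <= 1)%N.
  by rewrite -(dvdn_Pexp2l _ _ (prime_gt1 p_prime)) -eP expn1 Sp.
have cfin1 w : finite_set (support (fun x => c x w)).
  by apply: sub_finite_set (cfin w 1%N) => x /=; rewrite (eqP (e1 x)) mulr1n.
have [g [gK' gK]] := partial_inverse (inj_comp hinj iinj).
have [phi phiE] := additive_reindex g c.
have [||f [fE fphi]] := @divisible_extension p p_prime G (J -> QZ)
    [set f | finite_set (support f)] tG (@subgroup_finite_support J) _
    [set u | exists2 w, u.1 = i w & u.2 = phi w].
- by move=> f fin_f; exact: finite_support_divisible.
- split; first split.
  + by exists 0; rewrite ?raddf0.
  + move=> [x u] [y v] [w /= -> ->] [z /= -> ->].
    by exists (w - z); rewrite ?raddfB.
  + by move=> v [w /= + ->]; rewrite -(raddf0 i) => /iinj <-; rewrite raddf0.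
  + by move=> u [w _ ->]; rewrite /= phiE;
    exact: finite_support_reindex gK (cfin1 w).
(* By descending induction on m: p^m x lies in the socle, where f is phi. *)
have f_ker x : f x = 0 -> x = 0.
  move=> fx; have [m] := tG x; elim: m => [|m IH]; first by rewrite mulr1n.
  rewrite expnSr mulrnA => xm; apply: IH.
  have [w _ iw] : range i (x *+ p ^ m) by rewrite iE.
  have phiw : phi w = 0.
    have <- : f (i w) = phi w by apply: fphi; exists w.
    by rewrite iw raddfMn fx mul0rn.
  have [z wz] : exists z, w = z *+ p ^ 1.
    apply: c0 => y; suff -> : c y w = 0 by rewrite mul0rn.
    have /(congr1 (@^~ (h (i y)))) := phiw.
    by rewrite phiE /reindex (_ : g _ = Some y) // gK'.
  by rewrite -iw wz expn1 Sp raddf0.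
exists f; split=> // x y fxy; apply/eqP; rewrite -subr_eq0; apply/eqP/f_ker.
by rewrite raddfB fxy subrr.
Qed.
End Embeddings.

(** * Purity in p-groups *)

Section PureEmbeddings.
Variables (p : nat) (p_prime : prime p) (G H : zmodType).
Variable f : {additive G -> H}.

(** In a p-group multiplication by an integer prime to p is bijective, so only
    the powers of p matter for purity. *)
Lemma pure_embedding_p_power : (forall x : G, exists m, x *+ p ^ m = 0) ->
  injective f ->
  (forall x k y, f x = y *+ p ^ k -> exists z, x = z *+ p ^ k) ->
  pure_embedding f.
Proof.
move=> tG finj fdiv; split=> //; split.
  split=> [|_ _ /set_mem[x _ <-] /set_mem[y _ <-]]; apply/mem_set.
    by exists 0; rewrite ?raddf0.
  by exists (x - y); rewrite ?raddfB.
move=> n; apply/seteqP; split=> [_ [[y _ <-] [x _ xy]]|_ [_ [x _ <-] <-]];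
  last first.
  by split; [exists (f x)|exists (x *+ n); rewrite ?raddfMn].
suff [z xz] : exists z, x = z *+ n.
  by exists (f z); [exists z|rewrite -raddfMn -xz xy].
have [n0|n_gt0] := posnP n.
  by exists 0; apply: finj; rewrite xy n0 !mulr0n raddf0.
have [u pu nE] := pfactor_coprime p_prime n_gt0.
have [z xz] : exists z, x = z *+ p ^ logn p n.
  by apply: (fdiv x _ (y *+ u)); rewrite -mulrnA -nE.
have u_gt0 : (0 < u)%N by move: n_gt0; rewrite nE muln_gt0 => /andP[].
have [m zm] := tG z; have [v [w vw]] := inverse_mod_power m u_gt0 pu.
exists (z *+ v).
rewrite [in RHS]nE mulrnA -[z *+ v *+ u]mulrnA [(v * u)%N]mulnC vw mulrnDr.
by rewrite mulnC mulrnA zm mul0rn add0r xz.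
Qed.

Lemma pure_embedding_divide x k y : pure_embedding f ->
  f x = y *+ k -> exists z, x = z *+ k.
Proof.
move=> [finj [_ /(_ k) pure]] fxy.
have : ([set h *+ k | h in [set: H]] `&` range f) (f x).
  by split; [exists y|exists x].
by rewrite pure => -[_ [z _ <-] E]; exists z; apply: finj; rewrite raddfMn.
Qed.
End PureEmbeddings.

(** * Sets of cardinality at most the continuum *)

Section Continuum.

Lemma le_cantor_prod (A B : Type) :
  [set: A] #<= [set: nat -> bool] -> [set: B] #<= [set: nat -> bool] ->
  [set: A * B] #<= [set: nat -> bool].
Proof.
move=> /card_leTTP[f finj] /card_leTTP[g ginj]; apply/card_leTTP.
(* The two codes are interleaved. *)
exists (fun u n => if odd n then f u.1 n./2 else g u.2 n./2).
move=> [a b] [a' b'] /= E; congr pair.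
  apply/finj/funext => n; have /(congr1 (@^~ n.*2.+1)) := E.
  by rewrite /= odd_double uphalf_double.
apply/ginj/funext => n; have /(congr1 (@^~ n.*2)) := E.
by rewrite odd_double doubleK.
Qed.

Lemma le_cantor_seq (A : Type) : [set: A] #<= [set: nat -> bool] ->
  [set: nat -> A] #<= [set: nat -> bool].
Proof.
move=> /card_leTTP[f finj]; apply/card_leTTP.
exists (fun s n => if unpickle n is Some (i, j) then f (s i) j else false).
move=> s t E; apply/funext => i; apply/finj/funext => j.
by have /(congr1 (@^~ (pickle (i, j)))) := E; rewrite /= pickleK.
Qed.

Lemma le_cantor_countable (A : Type) : countable [set: A] ->
  [set: A] #<= [set: nat -> bool].
Proof.
move=> cA; apply: card_le_trans cA _; apply/card_leTTP.
exists (fun n m => n == m) => m n /(congr1 (@^~ n)); rewrite eqxx => /eqP.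
exact.
Qed.

Lemma le_cantor_option (A : Type) : [set: A] #<= [set: nat -> bool] ->
  [set: option A] #<= [set: nat -> bool].
Proof.
move=> /card_leTTP[f finj]; apply/card_leTTP.
exists (fun o n =>
  if o is Some a then if n is m.+1 then f a m else true else false).
move=> [a|] [b|] // E; try by have := congr1 (@^~ 0%N) E.
by congr Some; apply/finj/funext => n; have := congr1 (@^~ n.+1) E.
Qed.

(** The code enumerates the graph of the function over its support. *)
Lemma countable_support_code (J : Type) :
  exists code : (J -> QZ) -> nat -> option (J * QZ),
  forall f g, countable (support f) -> countable (support g) ->
    code f = code g -> f = g.
Proof.
have /choice[code codeP] : forall f : J -> QZ,
  exists s : nat -> option (J * QZ),
    countable (support f) ->
    forall j v, (exists n, s n = Some (j, v)) <-> support f j /\ f j = v.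
  move=> f; have [/countable_injP[r rinj]|] := pselect (countable (support f));
    last first.
    by exists (fun=> None).
  have /choice[s sP] : forall n, exists o : option (J * QZ),
      if o is Some (j, v) then [/\ support f j, r j = n & f j = v]
      else forall j, support f j -> r j <> n.
    move=> n; have [[j [fj rj]]|nj] :=
      pselect (exists j, support f j /\ r j = n).
      by exists (Some (j, f j)).
    by exists None => j fj rj; apply: nj; exists j.
  exists s => _ j v; split=> [[n sn]|[fj fv]].
    by have := sP n; rewrite sn => -[].
  exists (r j); have := sP (r j);
    case: (s (r j)) => [[i w] [fi rij <-]|/(_ j fj)//].
  by rewrite -fv (rinj _ _ (mem_set fi) (mem_set fj) rij).
exists code => f g cf cg fg; apply/funext => j.
have [fj|/contrapT fj] := pselect (support f j).
  have /codeP : support f j /\ f j = f j by [].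
  by move=> /(_ cf); rewrite fg => /(codeP _ cg)[].
have [gj|/contrapT->//] := pselect (support g j).
have := (codeP g cg j (g j)).2 (conj gj erefl).
by rewrite -fg => /(codeP _ cf)[].
Qed.
End Continuum.

(** * The universal group under the continuum hypothesis *)

Section Universal.
Variables (p : nat) (p_prime : prime p).

Let p_gt0 : (0 < p)%N := prime_gt0 p_prime.

(** When the value v i lies in the cyclic group of order p^(i.2), this multiple
    of it vanishes exactly when the value is divisible by p^k there. *)
Definition layer (v : omega1 * nat -> QZ) k (i : omega1 * nat) :=
  v i *+ p ^ (i.2 - k).

(** The p-primary part of a direct sum of copies of QZ, times the torsion
    completion of the direct sum, over the exponents n, of aleph_1 cyclic groups
    of order p^n: the finiteness of all layers is convergence in the p-adic
    topology. *)
Definition universal_set : set ((omega1 -> QZ) * (omega1 * nat -> QZ)) :=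
  [set u | [/\ exists m, u *+ p ^ m = 0, finite_set (support u.1),
    forall i, u.2 i *+ p ^ i.2 = 0
    & forall k, finite_set (support (layer u.2 k))]].

Lemma layerB v w k : layer (v - w) k = layer v k - layer w k.
Proof. by apply/funext => i; rewrite /layer mulrnBl. Qed.

Lemma universal_set_subgroup : subgroup universal_set.
Proof.
split=> [|u v [[m um] fin_u ku lu] [[n vn] fin_v kv lv]].
  split=> [||i|k]; first by exists 0%N.
  - exact: (subgroup_finite_support omega1).1.
  - by rewrite mul0rn.
  - rewrite (_ : layer _ k = 0); first exact: (subgroup_finite_support _).1.
    by apply/funext => i; rewrite /layer mul0rn.
split=> [||i|k].
- by apply: (subgroup_torsion p _).2; [exists m|exists n].
- exact: (subgroup_finite_support omega1).2.
- by rewrite mulrnBl ku kv subr0.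
- by rewrite layerB; exact: ((subgroup_finite_support _).2 _ _ (lu k) (lv k)).
Qed.

(** The support of the second component is the union of the supports of its
    layers, hence countable. *)
Lemma universal_set_card : universal_set #<= [set: nat -> bool].
Proof.
have [code1 code1P] := countable_support_code omega1.
have [code2 code2P] := countable_support_code (omega1 * nat).
have c0 : [set: omega1] #<= [set: nat -> bool].
  by apply/card_leTTP; exists val; exact: val_inj.
have cn := le_cantor_countable (countableP [set: nat]).
have cQ := le_cantor_countable QZ_countable.
have cT := le_cantor_prod
  (le_cantor_seq (le_cantor_option (le_cantor_prod c0 cQ)))
  (le_cantor_seq (le_cantor_option (le_cantor_prod (le_cantor_prod c0 cn) cQ))).
have cs u : universal_set u ->
    countable (support u.1) /\ countable (support u.2).
  move=> [_ fin_u _ lu]; split; first exact: finite_set_countable.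
  have : countable (\bigcup_k support (layer u.2 k)).
    by apply: bigcup_countable => // k _; exact: finite_set_countable.
  apply: sub_countable; apply: subset_card_le => i ui; exists i.2 => //.
  by rewrite /support /layer /= subnn expn0 mulr1n.
apply: card_le_trans cT.
pose code u := (code1 u.1, code2 u.2).
have code_inj : {in universal_set &, injective code}.
  move=> [f g] [f' g'] /set_mem/cs[/= cf cg] /set_mem/cs[/= cf' cg'] [E1 E2].
  by rewrite (code1P _ _ cf cf' E1) (code2P _ _ cg cg' E2).
have /card_eqPle[_ /card_le_trans] := inj_card_eq code_inj; apply.
exact: card_leT.
Qed.

(** A p-group of cardinality aleph_1 is mapped to its divisible embedding paired
    with its coordinates, the coordinate of x being placed at an index whose
    second entry is the exponent of x. *)
Theorem CH_universal : [set: nat -> bool] #= [set: omega1] ->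
  has_universal_p_group p omega1.
Proof.
move=> CH; have [U [i [iinj iE]]] :=
  subgroup_as_group (subgroup_zmod_closed universal_set_subgroup).
have Ui w : universal_set (i w) by rewrite -iE; exists w.
have lift u : universal_set u -> exists w, i w = u.
  by rewrite -iE => -[w _]; exists w.
have tU (w : U) : exists m, w *+ p ^ m = 0.
  by have [[m wm] _ _ _] := Ui w; exists m; apply: iinj; rewrite raddfMn raddf0.
exists U; split; first exact/(abelian_p_groupP p_prime).
- apply: Cantor_Bernstein.
    have /card_eqPle[_ +] :=
      @inj_card_eq _ _ [set: U] i (fun x y _ _ => @iinj x y).
    rewrite iE => /card_le_trans; apply;
      apply: card_le_trans universal_set_card _.
    by case/card_eqPle: CH.
  pose single b (j : omega1) : QZ := if j == b then proot p 1 else 0.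
  have /choice[w wE] : forall b, exists w, i w = (single b, 0).
    move=> b; apply: lift; split=> /= [||j|k].
    + exists 1%N; rewrite pair_mulrn mul0rn natmulfctE; congr pair.
      apply/funext => j; rewrite /single; case: eqP => _;
        last by rewrite mul0rn.
      by apply/eqP; rewrite proot_order.
    + apply: sub_finite_set (finite_set1 b) => j; rewrite /support /single /=.
      by case: eqP.
    + by rewrite mul0rn.
    + rewrite (_ : layer _ k = 0); first exact: (subgroup_finite_support _).1.
      by apply/funext => j; rewrite /layer mul0rn.
  apply/card_leTTP; exists w => a b /(congr1 i);
    rewrite !wE => -[/(congr1 (@^~ a))].
  by rewrite /single eqxx; case: eqP => // _ /(proot1_neq0 p_prime).
move=> N /(abelian_p_groupP p_prime) tN cN.
have /card_leTTP[h hinj] : [set: N] #<= [set: omega1] by case/card_eqPle: cN.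
have [f [finj ffin]] := divisible_embedding p_prime tN hinj.
have [e [c [eP ck cfin c0]]] := torsion_coordinates p_prime tN.
have hinj2 : injective (fun x => (h x, e x)) by move=> x y [/hinj].
have [g [gK hK]] := partial_inverse hinj2.
have [F FE] := additive_reindex g c.
have U_F x : universal_set (f x, F x).
  split=> /= [||j|k]; [|exact: ffin| |].
  - by have [m xm] := tN x; exists m; rewrite pair_mulrn -!raddfMn xm !raddf0.
  - rewrite FE /reindex; have := hK j; case: (g j) => [y /= <-|_];
    last exact: mul0rn.
    exact: ck.
  - apply: sub_finite_set (finite_image (fun y => (h y, e y)) (cfin x k)) => j.
    rewrite /support /layer FE /reindex /=; have := hK j.
    case: (g j) => [y /= <-|_]; last by rewrite mul0rn.
    by exists y.
have [q0 q0E] := choice (fun x => lift _ (U_F x)).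
have [|q qE] := @additive_of_add N U q0.
  by move=> x y; apply: iinj; rewrite raddfD !q0E !raddfD.
exists q; apply: (pure_embedding_p_power p_prime tN) => [x y|x k w qx].
  by rewrite !qE => /(congr1 i); rewrite !q0E => -[/finj].
apply: c0 => y; have := congr1 i qx; rewrite qE q0E raddfMn.
have [_ _ + _] := Ui w; case: (i w) => u v /= vk; rewrite pair_mulrn => -[_].
(* The coordinate at y is p^k times a value killed by p^(e y), and
   k + (e y - k) is at least e y. *)
move=> /(congr1 (@^~ (h y, e y))); rewrite FE /reindex gK => ->.
rewrite natmulfctE -mulrnA -expnD; apply/eqP.
have /subnK <- : (e y <= k + (e y - k))%N by lia.
by rewrite expnD mulnC mulrnA vk mul0rn.
Qed.
End Universal.

(** * Comparing the filtrations of a group and of a pure extension *)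

Section Transfer.
Variables (p : nat) (N U : zmodType) (f : {additive N -> U}).
Variables (B : omega1 -> set N) (e : U -> omega1).
Hypothesis f_divide : forall x k y, f x = y *+ k -> exists z, x = z *+ k.
Hypothesis cB : forall c, countable (B c).
Hypothesis denseB : forall x k, exists c b z, B c b /\ x = b + z *+ p ^ k.
Hypothesis e_inj : injective e.

(** Let N be filtered by the sets B c and U by the sets of u with e u < a. The
    function h bounds, for each stage, where its elements land in U and where
    the elements of U that agree with the image of N modulo some p^k find a
    witness in the filtration of N. At an ordinal closed under h, lying in
    stage a modulo p^k then means the same on both sides: downwards by purity
    of the image, after replacing the element of U by such a witness. *)
Lemma invariant_transfer : exists h : omega1 -> omega1, forall a,
  (forall b, (b < a)%O -> (h b < a)%O) -> forall x k,
  (exists c b z, [/\ (c < a)%O, B c b & x = b + z *+ p ^ k]) <->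
  (exists u v, (e u < a)%O /\ f x = u + v *+ p ^ k).
Proof.
have /choice[ch chP] : forall uk : U * nat, exists c0, forall c b v, B c b ->
    uk.1 = f b + v *+ p ^ uk.2 ->
    exists b' v', B c0 b' /\ uk.1 = f b' + v' *+ p ^ uk.2.
  move=> [u k] /=; have [[c [b [v [Bb ub]]]]|nc] :=
    pselect (exists c b v, B c b /\ u = f b + v *+ p ^ k).
    by exists c => _ _ _ _ _; exists b, v.
  by exists (e 0) => c b v Bb ub; case: nc; exists c, b, v.
have /choice[h hP] : forall c, exists d,
    (forall b, B c b -> (e (f b) < d)%O) /\
    (forall u k, (e u <= c)%O -> (ch (u, k) < d)%O).
  move=> c; pose A := (e \o f) @` B c `|`
    ch @` ([set u | (e u <= c)%O] `*` [set: nat]).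
  have [|d dP] := @omega1_bounded A.
    rewrite /A -bigcup2E; apply: bigcup_countable => // -[|[|i]] _ //=;
      apply: sub_countable (card_image_le _ _) _ => //.
    apply: countableX => //.
    exact: (countable_injective e_inj (fun _ => id) (omega1_countable_seg c)).
  exists d; split=> [b Bb|u k uc]; apply: dP; first by left; exists b.
  by right; exists (u, k).
exists h => a ha x k; split=> [[c [b [z [ca Bb ->]]]]|[u [v [ua fx]]]].
  exists (f b), (f z); rewrite raddfD raddfMn; split=> //.
  exact: lt_trans ((hP c).1 _ Bb) (ha _ ca).
have [c [b [z [Bb xb]]]] := denseB x k.
have [|b' [v' [Bb' /= ub']]] := chP (u, k) c b (f z - v) Bb.
  by rewrite /= mulrnBl addrA -raddfMn -raddfD -xb fx addrK.
have [z' xz'] : exists z', x - b' = z' *+ p ^ k.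
  by apply: (f_divide (y := v + v'));
    rewrite raddfB fx ub' mulrnDl addrC addrA addKr addrC.
exists (ch (u, k)), b', z'; split=> //; last by rewrite -xz' addrC subrK.
exact: lt_trans ((hP (e u)).2 _ _ (lexx _)) (ha _ ua).
Qed.
End Transfer.

(** * A group coding a set of natural numbers at every ladder *)

Section CodingGroup.
Variables (p : nat) (p_prime : prime p) (en : omega1 -> nat -> omega1).
Variable r : nat -> bool.

Let p_gt0 : (0 < p)%N := prime_gt0 p_prime.

Local Notation grid := (omega1 * nat)%type.

Definition basic (b : omega1) (n : nat) : grid -> QZ :=
  fun i => if i == (b, n) then proot p n.+1 else 0.

(** The infinite sum over the n in r with n >= k of p^(n-k) times the basic
    element at (en d n, n), where en d enumerates a ladder on d. For k = 0 all
    its terms have order p and their heights tend to infinity; the sums for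
    larger k are its successive quotients by p, up to finitely many terms. *)
Definition ladder_sum (d : omega1) (k : nat) : grid -> QZ :=
  fun i =>
    if [&& (k <= i.2)%N, r i.2 & i.1 == en d i.2] then proot p k.+1 else 0.

Lemma ladder_sum_rec d k : ladder_sum d k =
  (if r k then basic (en d k) k else 0) + ladder_sum d k.+1 *+ p.
Proof.
apply/funext => -[b n]; rewrite -[RHS]/(_ + _) natmulfctE /ladder_sum /=.
rewrite (fun_if (@^~ (b, n))) /basic /= xpair_eqE.
case: (ltngtP k n) => [kn|kn|<-] /=.
- rewrite andbF !if_same add0r; case: ifP => _; last by rewrite mul0rn.
  by rewrite prootS.
- by rewrite andbF !if_same mul0rn addr0.
- by rewrite andbT mul0rn addr0; case: (r k).
Qed.

(** Signs are included so that finite sums of generators form a group. *)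
Definition generator (t : omega1 * (nat * bool * bool)) : grid -> QZ :=
  let: (b, (n, ladder, sign)) := t in
  let v := if ladder then ladder_sum b n else basic b n in
  if sign then - v else v.

(** The constraint Q sees the ordinal, the exponent and the kind of a generator
    but not its sign. *)
Definition generated (Q : set (omega1 * (nat * bool))) : set (grid -> QZ) :=
  [set g | exists2 s : seq (omega1 * (nat * bool * bool)),
     forall t, t \in s -> Q (t.1, t.2.1) & g = \sum_(t <- s) generator t].

Lemma generated_subgroup Q : subgroup (generated Q).
Proof.
split=> [|_ _ [s Qs ->] [t Qt ->]]; first by exists [::]; rewrite ?big_nil.
pose flip (u : omega1 * (nat * bool * bool)) := (u.1, (u.2.1, ~~ u.2.2)).
exists (s ++ map flip t) => [u|].
  by rewrite mem_cat => /orP[/Qs//|/mapP[v vt ->]]; exact: (Qt v vt).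
rewrite big_cat big_map -sumrN; congr (_ + _);
  apply: eq_bigr => -[b [[n l] sg]] _.
by case: sg; rewrite /= ?opprK.
Qed.

Lemma generated_basic (Q : set (omega1 * (nat * bool))) b n :
  Q (b, (n, false)) -> generated Q (basic b n).
Proof.
move=> Qb; exists [:: (b, (n, false, false))]; rewrite ?big_seq1 // => t.
by rewrite inE => /eqP->.
Qed.

Lemma generated_ladder (Q : set (omega1 * (nat * bool))) d k :
  Q (d, (k, true)) -> generated Q (ladder_sum d k).
Proof.
move=> Qb; exists [:: (d, (k, true, false))]; rewrite ?big_seq1 // => t.
by rewrite inE => /eqP->.
Qed.

Lemma generated_min (Q : set (omega1 * (nat * bool))) A : subgroup A ->
  (forall b n, Q (b, (n, false)) -> A (basic b n)) ->
  (forall d k, Q (d, (k, true)) -> A (ladder_sum d k)) -> generated Q `<=` A.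
Proof.
move=> sA Ab Al _ [s Qs ->]; elim: s Qs => [|[b [[n l] sg]] s IH] Qs.
  by rewrite big_nil; exact: sA.1.
rewrite big_cons; apply: subgroupD => //; last first.
  by apply: IH => u us; apply: Qs; rewrite inE us orbT.
have /= := Qs _ (mem_head _ _).
by case: l {Qs}; case: sg => /= ?; try (apply: subgroupN => //);
  by [exact: Al|exact: Ab].
Qed.

Lemma generated_countable Q : countable Q -> countable (generated Q).
Proof.
move=> cQ; pose S := [set t : omega1 * (nat * bool * bool) | Q (t.1, t.2.1)].
have cS : countable S.
  apply: (countable_injective (f := fun t : omega1 * (nat * bool * bool) =>
    ((t.1, t.2.1), t.2.2)) _ _ (countableX cQ (countableP [set: bool]))).
    by move=> [b [nl s]] [b' [nl' s']] /= [-> -> ->].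
  by move=> t St; split.
apply: sub_countable (countable_seq_over cS).
apply: card_le_trans (card_image_le (fun s => \sum_(t <- s) generator t) _).
by apply: subset_card_le => _ [s Qs ->]; exists s.
Qed.

Definition coding_set : set (grid -> QZ) := generated setT.

Definition basic_upto c : set (grid -> QZ) :=
  generated [set t | (t.1 <= c)%O /\ ~~ t.2.2].

Lemma basic_upto_countable c : countable (basic_upto c).
Proof.
apply: generated_countable.
have cc := countableX (omega1_countable_seg c) (countableP [set: nat * bool]).
apply: sub_countable cc.
by apply: subset_card_le => t [].
Qed.

Lemma basic_upto_mono c d : (c <= d)%O -> basic_upto c `<=` basic_upto d.
Proof.
move=> cd _ [s Qs ->]; exists s => // t /Qs[tc nt]; split=> //.
exact: le_trans cd.
Qed.

Lemma basic_upto_group c : basic_upto c `<=` coding_set.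
Proof. by move=> _ [s _ ->]; exists s. Qed.

Lemma basic_upto_support c b n v : basic_upto c v -> (c < b)%O -> v (b, n) = 0.
Proof.
move=> Bv cb; move: v Bv; apply: (generated_min (A := [set v | v (b, n) = 0])).
- split=> // u v /= u0 v0; by rewrite -[(u - v) _]/(u _ - v _) u0 v0 subrr.
- move=> b' m [/= b'c _]; rewrite /basic xpair_eqE.
  by rewrite (gt_eqF (le_lt_trans b'c cb)).
- by move=> d k [].
Qed.

(** Iterating the recursion k times leaves a head that involves only the first k
    points of the ladder, so any bound of these points bounds its stage. *)
Lemma ladder_sum_approx d c k m :
  (forall n, (m <= n < m + k)%N -> (en d n <= c)%O) ->
  exists2 v, basic_upto c v &
    ladder_sum d m = v + ladder_sum d (m + k) *+ p ^ k.
Proof.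
elim: k m => [|k IH] m dc.
  by exists 0; [exact: (generated_subgroup _).1|rewrite add0r addn0].
have [|v Bv Ev] := IH m.+1.
  by move=> n /andP[mn nk]; apply: dc; rewrite ltnW //= addnS -addSn.
exists ((if r m then basic (en d m) m else 0) + v *+ p); last first.
  by rewrite ladder_sum_rec Ev mulrnDl addrA -mulrnA -expnSr addnS.
apply: subgroupD; first exact: generated_subgroup; last first.
  by apply: subgroupMn => //; exact: generated_subgroup.
case: ifP => _; last exact: (generated_subgroup _).1.
by apply: generated_basic; split=> //=; apply: dc; lia.
Qed.

(** The basic elements are dense in the p-adic topology of the whole group; this
    is what makes the closing-off argument applicable to them. *)
Lemma coding_set_dense v k : coding_set v -> exists c b z,
  [/\ basic_upto c b, coding_set z & v = b + z *+ p ^ k].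
Proof.
move=> gv; move: v gv; apply: (generated_min (A := [set v | exists c b z,
  [/\ basic_upto c b, coding_set z & v = b + z *+ p ^ k]])).
- split=> [|_ _ [c [b [z [Bb gz ->]]]] [c' [b' [z' [Bb' gz' ->]]]]].
    have [o _] := omega1_nonempty.
    exists o, 0, 0; rewrite mul0rn addr0; split=> //;
      exact: (generated_subgroup _).1.
  exists (Order.max c c'), (b - b'), (z - z').
  rewrite mulrnBl opprD addrACA; split=> //;
    last exact: (generated_subgroup _).2.
  apply: (generated_subgroup _).2.
    by apply: basic_upto_mono Bb; rewrite le_max lexx.
  by apply: basic_upto_mono Bb'; rewrite le_max lexx orbT.
- move=> b n _; exists b, (basic b n), 0; rewrite mul0rn addr0; split=> //.
    by apply: generated_basic; split=> /=.
  exact: (generated_subgroup _).1.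
- move=> d m _; have [|c cP] := @omega1_bounded (range (en d)).
    exact: sub_countable (card_image_le _ _) _.
  have [|v Bv ->] := @ladder_sum_approx d c k m.
    by move=> n _; apply/ltW/cP; exists n.
  by exists c, v, (ladder_sum d (m + k)); split=> //; exact: generated_ladder.
Qed.

Lemma coding_set_exponent v i : coding_set v -> v i *+ p ^ i.2.+1 = 0.
Proof.
move=> gv; move: v gv;
  apply: (generated_min (A := [set v | v i *+ p ^ i.2.+1 = 0])).
- split=> [|u v /= u0 v0]; first by rewrite /= mul0rn.
  by rewrite -[(u - v) i]/(u i - v i) mulrnBl u0 v0 subrr.
- move=> b n _ /=; rewrite /basic; case: eqP => [->/=|_];
  last by rewrite mul0rn.
  by apply/eqP; rewrite proot_order.
- move=> d k _ /=; rewrite /ladder_sum; case: ifP => [/andP[ki _]|_];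
  last by rewrite mul0rn.
  by apply/eqP; rewrite proot_order // dvdn_exp2l.
Qed.

Lemma coding_set_torsion v : coding_set v -> exists m, v *+ p ^ m = 0.
Proof.
move=> gv; move: v gv; apply: (generated_min (subgroup_torsion p _)).
- move=> b n _; exists n.+1; rewrite natmulfctE; apply/funext => i.
  rewrite /basic; case: eqP => _; last by rewrite mul0rn.
  by apply/eqP; rewrite proot_order.
- move=> d k _; exists k.+1; rewrite natmulfctE; apply/funext => i.
  rewrite /ladder_sum; case: ifP => _; last by rewrite mul0rn.
  by apply/eqP; rewrite proot_order.
Qed.

(** Peeling off the terms below j leaves p^j times a ladder sum, which is
    divisible by p^(j+1) when j is not in r. When j is in r, the value of the
    ladder sum at the grid point (en d j, j) is a nonzero element of order p,
    whereas elements of earlier stages vanish there, and so do multiples of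
    p^(j+1). *)
Lemma ladder_sum_codes d a0 j : (a0 < en d 0)%O ->
  (forall m n, (m < n)%N -> (en d m < en d n)%O) ->
  (exists c b z, [/\ (c < en d j)%O, basic_upto c b, coding_set z
     & ladder_sum d 0 = b + z *+ p ^ j.+1]) <-> ~~ r j.
Proof.
move=> a0d en_mono; split=> [[c [b [z [cd Bb gz E]]]]|nrj].
  apply/negP => rj; have := congr1 (@^~ (en d j, j)) E.
  rewrite -[RHS]/(b _ + (z *+ p ^ j.+1) _) (basic_upto_support _ Bb cd)
    natmulfctE.
  rewrite (coding_set_exponent (en d j, j) gz) addr0 /ladder_sum /= rj eqxx /=.
  exact: proot1_neq0.
have [c cd cP] : exists2 c, (c < en d j)%O &
    forall n, (n < j)%N -> (en d n <= c)%O.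
  (* For j = 0 the head is empty, but a stage below en d 0 is still needed. *)
  case: (j) => [|i]; first by exists a0.
  exists (en d i); first exact: en_mono.
  by move=> n; rewrite ltnS leq_eqVlt => /orP[/eqP->//|/en_mono/ltW].
have [|b Bb E] := @ladder_sum_approx d c j 0 _; first exact: cP.
exists c, b, (ladder_sum d j.+1); split=> //; first exact: generated_ladder.
by rewrite E add0n (ladder_sum_rec d j) (negbTE nrj) add0r -mulrnA expnS.
Qed.

Lemma coding_group :
  exists (N : zmodType) (B : omega1 -> set N) (y : omega1 -> N),
  [/\ abelian_p_group p N, [set: N] #= [set: omega1], forall c, countable (B c),
      forall x k, exists c b z, B c b /\ x = b + z *+ p ^ k
    & forall d a0 j, (a0 < en d 0)%O ->
        (forall m n, (m < n)%N -> (en d m < en d n)%O) ->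
        (exists c b z, [/\ (c < en d j)%O, B c b & y d = b + z *+ p ^ j.+1]) <->
        ~~ r j].
Proof.
have [N [i [iinj iE]]] :=
  subgroup_as_group (subgroup_zmod_closed (generated_subgroup setT)).
have Ni x : coding_set (i x) by rewrite /coding_set -iE; exists x.
have lift v : coding_set v -> exists x, i x = v.
  by rewrite /coding_set -iE => -[x _]; exists x.
have /choice[y yE] d : exists y, i y = ladder_sum d 0.
  exact/lift/generated_ladder.
exists N, (fun c => i @^-1` basic_upto c), y; split.
- apply/(abelian_p_groupP p_prime) => x;
  have [m xm] := coding_set_torsion (Ni x).
  by exists m; apply: iinj; rewrite raddfMn raddf0.
- apply: Cantor_Bernstein.
    apply: card_le_trans (omega1_seq_le (nat * bool * bool)%type).
    have /choice[s sE] x : exists s, i x = \sum_(t <- s) generator t.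
      by have [s _ ->] := Ni x; exists s.
    by apply/card_leTTP; exists s => u v suv; apply: iinj; rewrite !sE suv.
  have /choice[x xE] b : exists x, i x = basic b 0.
    exact/lift/generated_basic.
  apply/card_leTTP; exists x => a b /(congr1 i);
    rewrite !xE => /(congr1 (@^~ (a, 0))).
  rewrite /basic eqxx xpair_eqE andbT; case: eqP => // _.
  by move/(proot1_neq0 p_prime).
- move=> c; apply: countable_injective iinj _ (basic_upto_countable c).
  by move=> x.
- move=> x k; have [c [b [z [Bb gz E]]]] := coding_set_dense k (Ni x).
  have [b' b'E] := lift b (basic_upto_group Bb); have [z' z'E] := lift z gz.
  exists c, b', z'; split; first by rewrite /preimage /= b'E.
  by apply: iinj; rewrite E raddfD raddfMn b'E z'E.
- move=> d a0 j a0d en_mono; rewrite -(ladder_sum_codes j a0d en_mono).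
  split=> [[c [b [z [cd Bb E]]]]|[c [b [z [cd Bb gz E]]]]].
    by exists c, (i b), (i z); split=> //; rewrite -yE E raddfD raddfMn.
  have [b' b'E] := lift b (basic_upto_group Bb); have [z' z'E] := lift z gz.
  exists c, b', z'; split=> //; first by rewrite /preimage /= b'E.
  by apply: iinj; rewrite yE E raddfD raddfMn b'E z'E.
Qed.
End CodingGroup.

(** The set of codes realised by pairs of an element of U and an ordinal has at
    most aleph_1 members. Every r is realised: club provides a ladder consisting
    of closed ordinals, along which the code of the ladder sum survives the
    embedding into U. *)
Theorem club_no_universal (p : nat) : prime p ->
  card_lt [set: omega1] [set: nat -> bool] -> club_principle ->
  ~ has_universal_p_group p omega1.
Proof.
move=> p_prime [_ not_le] [A [A_omega club]] [U [_ cardU univ]].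
have /card_leTTP[e e_inj] : [set: U] #<= [set: omega1].
  by case/card_eqPle: cardU.
have /choice[en enP] d : exists f : nat -> omega1, limit_ordinal d ->
    (forall m n, (m < n)%N -> (f m < f n)%O) /\ range f `<=` A d.
  have [ld|nld] := pselect (limit_ordinal d); last by exists (fun=> e 0).
  have [_ [f f_mono fE]] := A_omega d ld; exists f => _; rewrite fE;
    split=> // m n mn.
  by rewrite ltNge f_mono -ltnNge.
(* The code of an element of U along the ladder on an ordinal. *)
pose inv (ud : U * omega1) j := ~~ `[< exists u v, (e u < en ud.2 j)%O /\
  ud.1 = u + v *+ p ^ j.+1 >].
suff /choice[s sP] : forall r, exists ud, inv ud = r.
  apply: not_le; apply: card_le_trans omega1_square_le; apply/card_leTTP.
  exists (fun r => (e (s r).1, (s r).2)) => q r [/e_inj E1 E2].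
  by rewrite -(sP q) -(sP r); congr inv;
    rewrite [LHS]surjective_pairing E1 E2 -surjective_pairing.
move=> r; have [N [B [y [pN cardN cB denseB codes]]]] :=
  coding_group p_prime en r.
have [f pure_f] := univ N pN cardN.
have [h hP] := invariant_transfer (fun x k z =>
  @pure_embedding_divide _ _ f x k z pure_f)
  cB denseB e_inj.
(* The ladder on d consists of ordinals closed under h; they are moreover above
   e 0, so that some stage of N precedes the first of them. *)
have [d ld dC] := club _ (@uncountable_closed h (e 0)).
have [en_mono enA] := enP d ld.
have C n : (e 0 < en d n)%O /\ forall b, (b < en d n)%O -> (h b < en d n)%O.
  by apply/dC/enA; exists n.
exists (f (y d), d); apply/funext => j; rewrite /inv /=.
have := codes d (e 0) j (C 0).1 en_mono; rewrite (hP _ (C j).2).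
by case: (r j) => /= H; [apply/asboolPn => /H|apply/negbF/asboolP/H].
Qed.

Theorem lemma3p10 (p : nat) (hp : prime p) :
  ([set: nat -> bool] #= [set: omega1] -> has_universal_p_group p omega1) /\
  (card_lt [set: omega1] [set: nat -> bool] -> club_principle ->
   ~ has_universal_p_group p omega1).
Proof. by split; [exact: CH_universal|exact: club_no_universal]. Qed.
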